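(* Let $n\ge 2$ be an integer. There exists an orthogonal matrix $Q^{(\mathrm{ph})}$ in the cycle family of order $n$ (in particular with first column $\mathbf 1/\sqrt n$) such that \[ M\big(Q^{(\mathrm{ph})}\big)= \begin{cases} 2\cos^2(\pi/n), & n\equiv 0\pmod 4,\\ 2\cos^2(\pi/(2n)), & n\equiv 2\pmod 4,\\ 2\cos^2(\pi/(4n)), & n\ \text{odd}, \end{cases} \] and this value is optimal within the cycle family, i.e. $M(Q)\ge M(Q^{(\mathrm{ph})})$ for every $Q$ in the cycle family of order $n$. Consequently, \[ \delta^{(\mathrm{ph})}_n:=1-\frac{1}{M(Q^{(\mathrm{ph})})}= \begin{cases} 1-\dfrac{1}{2\cos^2(\pi/n)}, & n\equiv 0\pmod 4,\\[2mm] 1-\dfrac{1}{2\cos^2(\pi/(2n))}, & n\equiv 2\pmod 4,\\[2mm] 1-\dfrac{1}{2\cos^2(\pi/(4n))}, & n\ \text{odd}, \end{cases} \] and $0\le\delta^{(\mathrm{ph})}_n<\tfrac12$ for every $n\ge 3$. Moreover, $\delta^{(\mathrm{ph})}_n=\delta_n$ unless $8\mid n$, and in each of the three cases ($n\equiv 0\pmod 4$, $n\equiv 2\pmod 4$, $n$ odd) $\delta^{(\mathrm{ph})}_n$ increases to $\tfrac12$ as $n\to\infty$ within that class.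
   Context: For a real orthogonal $n\times n$ matrix $Q=[q_0,\dots,q_{n-1}]$ with first column $q_0=\mathbf 1/\sqrt n$ ($\mathbf 1$ the all-ones vector; coordinates indexed by $0,\dots,n-1$), its coherence is \[ M(Q):=\sup_{1\le j\le n-1}\ \sup_{0\le k,l\le n-1} n\,|q_j(k)q_j(l)|=n\max_{1\le j\le n-1}\|q_j\|_\infty^2 . \] The cycle family of order $n$ consists of the real orthogonal matrices with first column $\mathbf 1/\sqrt n$ whose remaining columns are, up to order and sign: for each $j\in\{1,\dots,\lfloor (n-1)/2\rfloor\}$, a pair \[ w^{(\phi_j)}_j(k)=\sqrt{\tfrac2n}\sin\!\Big(\tfrac{2\pi jk}{n}+\phi_j\Big),\qquad \tilde w^{(\phi_j)}_j(k)=\sqrt{\tfrac2n}\cos\!\Big(\tfrac{2\pi jk}{n}+\phi_j\Big)\qquad(0\le k\le n-1), \] with an arbitrary phase $\phi_j\in\mathbb R$ chosen independently for each $j$ (this is an orthonormal basis of the two-dimensional eigenspace $E_j=\operatorname{span}\{\cos(2\pi jk/n),\sin(2\pi jk/n)\}$ of the $n$-cycle); and, when $n$ is even, the unit vector $w_{n/2}(k)=(-1)^k/\sqrt n$ spanning the one-dimensional eigenspace $E_{n/2}$. The quantity $\delta_n$ (the threshold for the canonical cycle basis) is \[ \delta_n:=1-\frac{1}{2\cos^2\Delta_n},\qquad \Delta_n:=\min_{m,t\in\mathbb Z}\left|\frac{2\pi m}{n}-\frac{(2t+1)\pi}{4}\right| . \] *)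

(* Defs.v *)
(* MathComp-Analysis; [R : realType] plays the role of the real numbers. *)
From HB Require Import structures.
From mathcomp Require Import all_boot all_order all_algebra all_fingroup.
From mathcomp Require Import all_classical all_reals all_analysis.

Set Implicit Arguments.
Unset Strict Implicit.
Unset Printing Implicit Defensive.

Import Order.TTheory GRing.Theory Num.Theory.
Import numFieldNormedType.Exports.

Local Open Scope classical_set_scope.
Local Open Scope ring_scope.

(* The columns of [Q] are q_0, ..., q_(n-1), i.e. q_j(k) is [Q k j]. *)
Definition orthogonal_mx (R : realType) (n : nat) (Q : 'M[R]_n) : Prop :=
  Q^T *m Q = 1%:M.

Definition first_col_const (R : realType) (n : nat) (Q : 'M[R]_n) : Prop :=
  forall k j : 'I_n, j = 0%N :> nat -> Q k j = 1 / Num.sqrt n%:R.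

(* The suprema range over finite families of nonnegative reals, nonempty for
   n >= 2, so the default value 0 is harmless. *)
Definition coherence (R : realType) (n : nat) (Q : 'M[R]_n) : R :=
  \big[Num.max/0]_(j < n | (0 < j)%N)
    \big[Num.max/0]_(k < n) \big[Num.max/0]_(l < n)
      (n%:R * `|Q k j * Q l j|).

Definition cycle_sin (R : realType) (n j : nat) (phi : R) (k : nat) : R :=
  Num.sqrt (2 / n%:R) * sin (2 * pi * j%:R * k%:R / n%:R + phi).

Definition cycle_cos (R : realType) (n j : nat) (phi : R) (k : nat) : R :=
  Num.sqrt (2 / n%:R) * cos (2 * pi * j%:R * k%:R / n%:R + phi).

Definition cycle_alt (R : realType) (n k : nat) : R :=
  (-1) ^+ k / Num.sqrt n%:R.

(* A reference order of the nonconstant columns, indexed by 1 <= i <= n - 1.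
   For 1 <= j <= (n - 1)/2 the sine vector of E_j has index j and the cosine
   vector of E_j, with the same phase, has index n - j; the index n/2, which
   is left over exactly when n is even, carries the alternating vector. *)
Definition cycle_col (R : realType) (n : nat) (phi : nat -> R) (i k : nat) : R :=
  if (i.*2 < n)%N then cycle_sin n i (phi i) k
  else if i.*2 == n then cycle_alt R n k
  else cycle_cos n (n - i) (phi (n - i)%N) k.

(* The permutation [s] and the signs [e] express "up to order and sign"; [s]
   preserves the set of nonzero indices, hence fixes the index 0. *)
Definition cycle_family (R : realType) (n : nat) (Q : 'M[R]_n) : Prop :=
  [/\ orthogonal_mx Q, first_col_const Q &
    exists (phi : nat -> R) (s : 'S_n) (e : 'I_n -> bool),
      forall i : 'I_n, (0 < i)%N ->
        (0 < s i)%N /\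
        forall k : 'I_n, Q k (s i) = (-1) ^+ e i * cycle_col n phi i k].

(* The infimum is attained: the values are of the form |integer| * pi/(4n). *)
Definition Delta (R : realType) (n : nat) : R :=
  inf [set x : R | exists m t : int,
    x = `|2 * pi * m%:~R / n%:R - (2 * t + 1)%:~R * pi / 4|].

Definition delta (R : realType) (n : nat) : R :=
  1 - 1 / (2 * cos (Delta R n) ^+ 2).

Definition threshold (R : realType) (n : nat) (Q : 'M[R]_n) : R :=
  1 - 1 / coherence Q.

Definition increases_to (R : realType) (C : set nat) (u : nat -> R) (l : R) :
    Prop :=
  (forall m n : nat, C m -> C n -> (m < n)%N -> u m < u n) /\
  u n @[n --> within C \oo] --> l.

(* Main.v *)
Require Import Defs.
From HB Require Import structures.
From mathcomp Require Import all_boot all_order all_algebra all_fingroup.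
From mathcomp Require Import all_classical all_reals all_analysis.
From mathcomp Require Import zify ring lra.

Set Implicit Arguments.
Unset Strict Implicit.
Unset Printing Implicit Defensive.

Import Order.TTheory GRing.Theory Num.Theory.
Import numFieldNormedType.Exports.

Local Open Scope classical_set_scope.
Local Open Scope ring_scope.

(** Put [L = lcm(4, n)] and [g = pi / L].  The single constant phase [g] for
every frequency is optimal, with coherence [2 * cos g ^+ 2]; the three cases of
the statement are the values [n], [2 * n], [4 * n] of [L].

The angles sampled by the frequency [j] are [2 * pi * j * k / n + phi].  Since
both a sine and a cosine column are present, an entry is large exactly when
its angle is close to a multiple of [pi / 2], so only angles modulo [pi / 2]
matter.  The numbers [2 * pi / n] and [pi / 2] generate the group of multiples
of [2 * pi / L = 2 * g].

Upper bound ([coherence_cycle_mx_le]): with phase [g] every sampled angle is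
an odd multiple of [g], and [pi / 2] is an even multiple of [g].  Hence no
angle is closer to [pi / 2 * Z] than [g], and every squared sine or cosine is
at most [cos g ^+ 2].  This holds for all [j] simultaneously.

Lower bound ([le_coherence_cycle]): for [j = 1] the angles, taken modulo
[pi / 2], run through a whole translate of the group of multiples of [2 * g],
whatever the phase is; some point of it lies within [g] of [pi / 2 * Z].  For
[n = 2] there is no pair of columns and the alternating vector gives the bound.

That the columns form an orthonormal basis ([cycle_mx_family]) reduces, by the
product-to-sum formulas, to the vanishing of sums of equally spaced cosines.

For the comparison with [Delta], multiply the distance
[2 * pi * m / n - (2 * t + 1) * pi / 4] by [1 / g]: it becomes the integer
[2 * e * m - (2 * t + 1) * u] with [L = e * n = 4 * u].  If [u] is odd this
integer is odd, so at least 1 in absolute value, and 1 is attained; [u] is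
even exactly when 8 divides [n], and then 0 is attained.

Finally [L] is a constant multiple of [n] on each residue class, so [g]
decreases strictly to 0 there and [1 - 1 / (2 * cos g ^+ 2)] increases
strictly to [1 / 2]. *)

(** * Squared cosines on arithmetic progressions *)

Lemma sqr_cosDzpi (R : realType) (x : R) (z : int) :
  cos (x + z%:~R * pi) ^+ 2 = cos x ^+ 2.
Proof.
have nat_case (m : nat) (y : R) : cos (y + m%:R * pi) ^+ 2 = cos y ^+ 2.
  rewrite mulr_natl (alternatingn (@cosDpi R)) exprMn.
  by rewrite sqrr_sign mul1r.
case: z => m; first by rewrite -pmulrn nat_case.
by rewrite NegzE mulrNz mulNr -pmulrn -(nat_case m.+1 (x - _)) subrK.
Qed.

(** A shift by [pi / 2] exchanges sine and cosine up to sign, so which of the two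
alternatives holds depends on the parity of [z]. *)
Lemma sqr_cosDzpihalf (R : realType) (x : R) (z : int) :
  cos (x + z%:~R * (pi / 2)) ^+ 2 = cos x ^+ 2 \/
  sin (x + z%:~R * (pi / 2)) ^+ 2 = cos x ^+ 2.
Proof.
have zE := divz_eq z 2; have : (0 <= z %% 2 < 2)%Z.
  by rewrite modz_ge0 // ltz_pmod.
move: (z %% 2)%Z zE => b zE b01.
have [b0|b1] : b = 0 \/ b = 1 by lia.
  left; rewrite -(sqr_cosDzpi x (z %/ 2)%Z) {1}zE b0 addr0 intrM.
  by congr (cos _ ^+ 2); field.
right; rewrite -cosBpihalf -(sqr_cosDzpi x (z %/ 2)%Z) {1}zE b1 intrD intrM.
by congr (cos _ ^+ 2); field.
Qed.

(** Among the multiples of [pi / (2 * N)], the odd ones are never closer than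
[pi / (2 * N)] to a multiple of [pi], because the multiples of [pi] are even
ones. *)
Lemma sqr_cos_le_odd (R : realType) (N p : nat) : (0 < N)%N -> odd p ->
  cos (p%:R * (pi / (2 * N%:R))) ^+ 2 <= cos (pi / (2 * N%:R)) ^+ 2 :> R.
Proof.
move=> N0 podd; set g : R := pi / _.
have NR : 0 < N%:R :> R by rewrite ltr0n.
have pi0 := pi_gt0 R.
have g0 : 0 < g by rewrite divr_gt0 // mulr_gt0.
have gN : (2 * N)%:R * g = pi by rewrite natrM /g; field; rewrite gt_eqF.
have /eqP pE := divn_eq p (2 * N).
have rlt : (p %% (2 * N) < 2 * N)%N by rewrite ltn_pmod // muln_gt0.
have rodd : odd (p %% (2 * N)) by rewrite odd_mod // oddM.
move: (p %% _)%N (p %/ _)%N pE rlt rodd => r q /eqP pE rlt rodd.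
(* [r] is the remainder of [p] modulo [2 * N]; it is odd, so that
   [g <= r * g <= pi - g], where the cosine is monotone. *)
have -> : cos (p%:R * g) ^+ 2 = cos (r%:R * g) ^+ 2.
  rewrite -(sqr_cosDzpi (r%:R * g) q) pE natrD natrM mulrDl -mulrA gN.
  by rewrite -pmulrn addrC.
have r1 : g <= r%:R * g by rewrite ler_peMl ?ler1n ?odd_gt0 // ltW.
have r2 : r%:R * g <= pi - g.
  by rewrite lerBrDr -[X in _ + X]mul1r -mulrDl natr1 -gN ler_pM2r // ler_nat.
have gpi : g <= pi - g by rewrite (le_trans r1).
rewrite -ler_sqrt ?sqr_ge0 // !sqrtr_sqr.
have cos_ge0 : 0 <= cos g by apply: cos_ge0_pihalf; lra.
rewrite (ger0_norm cos_ge0) ler_norml.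
have cosW (a b : R) : 0 <= a -> a <= b -> b <= pi -> cos b <= cos a.
  by move=> a0 ab bpi; rewrite leNgt ltr_cos -?leNgt // in_itv /=; lra.
apply/andP; split; last by apply: cosW => //; lra.
have -> : - cos g = cos (pi - g) by rewrite addrC cosDpi cosN.
by apply: cosW; lra.
Qed.

(** Any translate of a grid of spacing [pi / N] has a point within half a spacing
of a multiple of [pi]. *)
Lemma sqr_cos_grid (R : realType) (N : nat) (x : R) : (0 < N)%N ->
  exists r : nat,
    cos (pi / (2 * N%:R)) ^+ 2 <= cos (x + r%:R * (pi / N%:R)) ^+ 2.
Proof.
move=> N0; set g : R := pi / _.
have NR : 0 < N%:R :> R by rewrite ltr0n.
have pi0 := pi_gt0 R.
have g0 : 0 < g by rewrite divr_gt0 // mulr_gt0.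
have -> : pi / N%:R = 2 * g by rewrite /g; field; rewrite gt_eqF.
have gpi : g <= pi / 2.
  rewrite /g invfM mulrA ler_piMr ?divr_ge0 ?pi_ge0 //.
  by rewrite invf_le1 // ler1n.
(* [2 * g * m] is the grid point nearest to [x]; the index sought is the
   natural number congruent to [- m] modulo [N], because [N] steps make up
   [pi]. *)
pose m := Num.floor ((x + g) / (2 * g)).
have [m1 m2] : m%:~R * (2 * g) <= x + g /\ x + g < (m%:~R + 1) * (2 * g).
  have /andP[] := floor_itv ((x + g) / (2 * g)).
  rewrite -/m intrD => m1 m2.
  have g2 : 0 < 2 * g by rewrite mulr_gt0.
  by split; [rewrite -ler_pdivlMr | rewrite -ltr_pdivrMr].
have r0 : (0 <= (- m %% N)%Z)%R by rewrite modz_ge0 // eqz_nat -lt0n.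
exists `|(- m %% N)%Z|%N.
have rE : `|(- m %% N)%Z|%N%:R = - m%:~R - (- m %/ N)%Z%:~R * N%:R :> R.
  have /(congr1 (fun z : int => z%:~R : R)) := divz_eq (- m) N.
  by rewrite intrD intrM mulrNz -{1}(gez0_abs r0) -!pmulrn => ->; ring.
have gN : N%:R * (2 * g) = pi by rewrite /g; field; rewrite gt_eqF.
have -> : x + `|(- m %% N)%Z|%N%:R * (2 * g)
        = x - m%:~R * (2 * g) + (- (- m %/ N)%Z)%:~R * pi.
  by rewrite rE mulrNz -gN; ring.
rewrite sqr_cosDzpi; set y := x - _.
have yg : `|y| <= g by rewrite ler_norml /y; apply/andP; split; lra.
have cosg : 0 <= cos g by apply: cos_ge0_pihalf; lra.
rewrite -(cos_norm y) ler_sqr ?nnegrE //.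
  by rewrite leNgt ltr_cos -?leNgt // in_itv /= ?normr_ge0; lra.
apply: cos_ge0_pihalf; have := normr_ge0 y; lra.
Qed.

(** * Orthogonality of the cycle columns *)

Lemma cosDz2pi (R : realType) (x : R) (z : int) :
  cos (x + z%:~R * (2 * pi)) = cos x.
Proof.
have nat_case (m : nat) (y : R) : cos (y + m%:R * (2 * pi)) = cos y.
  by rewrite !mulr_natl (periodicn (@cosD2pi R)).
case: z => m; first by rewrite -pmulrn nat_case.
by rewrite NegzE mulrNz mulNr -pmulrn -(nat_case m.+1 (x - _)) subrK.
Qed.

(** After multiplication by [2 * sin (h / 2)] the sum telescopes. *)
Lemma sum_cos_arith (R : realType) (n : nat) (h psi : R) :
  2 * sin (h / 2) * \sum_(k < n) cos (k%:R * h + psi) =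
  sin (n%:R * h + (psi - h / 2)) - sin (psi - h / 2).
Proof.
elim: n => [|n IHn]; first by rewrite big_ord0 mulr0 mul0r add0r subrr.
rewrite big_ord_recr mulrDr {}IHn /=.
have -> : n%:R * h + (psi - h / 2) = n%:R * h + psi - h / 2 by ring.
have -> : n.+1%:R * h + (psi - h / 2) = n%:R * h + psi + h / 2.
  by rewrite -natr1; field.
set a := n%:R * h + psi; rewrite (sinB a) (sinD a); ring.
Qed.

(** Ensures that the telescoping factor of [sum_cos_arith] can be cancelled
unless the summands are all equal. *)
Lemma sin_piM_div_eq0 (R : realType) (n : nat) (m : int) : (0 < n)%N ->
  sin (pi * m%:~R / n%:R) = 0 :> R -> (n %| m)%Z.
Proof.
move=> n0 /eqP; rewrite -sqrf_eq0 -cosBpihalf.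
have nR : 0 < n%:R :> R by rewrite ltr0n.
have zE := divz_eq m n.
have r0 : (0 <= (m %% n)%Z)%R by rewrite modz_ge0 // eqz_nat -lt0n.
have rn : ((m %% n)%Z < n)%R by rewrite ltz_pmod.
rewrite (sameP dvdz_mod0P eqP).
move: (m %% n)%Z (m %/ n)%Z zE r0 rn => r q -> r0 rn.
have -> : pi * (q * n + r)%:~R / n%:R - pi / 2 =
          pi * r%:~R / n%:R - pi / 2 + q%:~R * pi :> R.
  by rewrite intrD intrM -pmulrn; field; rewrite gt_eqF.
rewrite sqr_cosDzpi cosBpihalf sqrf_eq0; apply: contraTT => rneq0.
rewrite gt_eqF // sin_gt0_pi //.
have rR : 0 < r%:~R :> R by rewrite ltr0z lt_neqAle eq_sym rneq0.
have pi0 := pi_gt0 R.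
rewrite divr_gt0 ?mulr_gt0 //= ltr_pdivrMr // ltr_pM2l //.
by rewrite [n%:R]pmulrn ltr_int.
Qed.

(** Real form of the orthogonality relations for the characters of the cyclic
group of order [n]. *)
Lemma sum_cos_roots (R : realType) (n : nat) (m : int) (psi : R) :
  (0 < n)%N ->
  \sum_(k < n) cos (2 * pi * m%:~R * k%:R / n%:R + psi) =
  if (n %| m)%Z then n%:R * cos psi else 0.
Proof.
move=> n0; have nR : n%:R != 0 :> R by rewrite pnatr_eq0 -lt0n.
case: ifPn => [/dvdzP[q ->]|ndvd].
  rewrite (eq_bigr (fun=> cos psi)) => [|k _].
    by rewrite sumr_const card_ord mulr_natl.
  rewrite -(cosDz2pi psi (q * k)); congr cos.
  by rewrite !intrM -!pmulrn; field.
pose h : R := 2 * pi * m%:~R / n%:R.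
have s0 : 2 * sin (h / 2) != 0 :> R.
  rewrite mulf_neq0 ?pnatr_eq0 //; apply: contra ndvd => /eqP sin0.
  apply: (@sin_piM_div_eq0 R) => //; rewrite -sin0; congr sin; rewrite /h.
  by field.
apply: (mulfI s0); rewrite mulr0.
rewrite (eq_bigr (fun k : 'I_n => cos (k%:R * h + psi))) => [|k _].
  rewrite sum_cos_arith -!cosBpihalf.
  have -> : n%:R * h + (psi - h / 2) - pi / 2 =
            psi - h / 2 - pi / 2 + m%:~R * (2 * pi) by rewrite /h; field.
  by rewrite cosDz2pi subrr.
by congr cos; rewrite /h; field.
Qed.

Definition cycle_mx (R : realType) (phi : nat -> R) (n : nat) : 'M[R]_n :=
  \matrix_(k, i) if val i == 0%N then 1 / Num.sqrt n%:R
                 else cycle_col n phi i k.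

(** With [cycle_amp] and [cycle_phase], every column [i] of [cycle_mx], including
the constant, the alternating and the sine ones, becomes an amplitude times
a cosine wave of frequency [i] (see [cycle_mxE]).  For [i.*2 > n] this reads
the frequency [n - i] as the frequency [- i], which reverses the phase. *)
Definition cycle_amp (R : realType) (n i : nat) : R :=
  if (i == 0)%N || (i.*2 == n) then 1 / Num.sqrt n%:R
  else Num.sqrt (2 / n%:R).

Definition cycle_phase (R : realType) (n : nat) (phi : nat -> R) (i : nat) : R :=
  if (i == 0)%N || (i.*2 == n) then 0
  else if (i.*2 < n)%N then phi i - pi / 2 else - phi (n - i)%N.

Lemma cycle_mxE (R : realType) (phi : nat -> R) (n : nat) (k i : 'I_n) :
  cycle_mx phi n k i =
  cycle_amp R n i *
  cos (2 * pi * i%:Z%:~R * k%:R / n%:R + cycle_phase n phi i).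
Proof.
have n0 : (0 < n)%N by apply: leq_ltn_trans (ltn_ord i).
have nR : n%:R != 0 :> R by rewrite pnatr_eq0 -lt0n.
rewrite mxE /cycle_amp /cycle_phase /cycle_col -pmulrn.
have [->|i0] /= := eqVneq (val i) 0%N.
  by rewrite mulr0 !mul0r addr0 cos0 mulr1.
have [i2n|i2n|i2n] /= := ltngtP.
- by rewrite /cycle_sin addrA cosBpihalf.
- rewrite /cycle_cos natrB 1?ltnW //; congr (_ * _).
  rewrite -cosN -(cosDz2pi _ k) -pmulrn; congr cos; field; exact: nR.
- rewrite /cycle_alt addr0 mulrC mul1r; congr (_ * _).
  have -> : 2 * pi * i%:R * k%:R / n%:R = 0 + pi *+ k :> R.
    have i0R : i%:R != 0 :> R by rewrite pnatr_eq0.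
    have -> : n%:R = i%:R * 2 :> R by rewrite -natrM muln2 i2n.
    by rewrite -mulr_natr; field.
  by rewrite (alternatingn (@cosDpi R)) cos0 mulr1.
Qed.

(** The product of two cosine waves of frequencies [i] and [j] is half the sum of
the waves of frequencies [i + j] and [i - j].  The only coincidence modulo [n]
for [i != j] is [i + j = n], the sine and the cosine vector of one eigenspace;
there the two phases add up to [- pi / 2], whose cosine vanishes. *)
Lemma cycle_mx_dot (R : realType) (phi : nat -> R) (n : nat) (i j : 'I_n) :
  \sum_k cycle_mx phi n k i * cycle_mx phi n k j = (i == j)%:R.
Proof.
have n0 : (0 < n)%N by apply: leq_ltn_trans (ltn_ord i).
have nR : n%:R != 0 :> R by rewrite pnatr_eq0 -lt0n.
pose p := cycle_phase n phi; pose c := cycle_amp R n.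
have sumE : \sum_k cycle_mx phi n k i * cycle_mx phi n k j =
   c i * c j / 2 * ((if (n %| i%:Z + j%:Z)%Z then n%:R * cos (p i + p j) else 0) +
   (if (n %| i%:Z - j%:Z)%Z then n%:R * cos (p i - p j) else 0)).
  rewrite -!sum_cos_roots // -big_split mulr_sumr /=; apply: eq_bigr => k _.
  rewrite !cycle_mxE -/p -/c.
  have -> : 2 * pi * (i%:Z + j%:Z)%:~R * k%:R / n%:R + (p i + p j) =
     (2 * pi * i%:Z%:~R * k%:R / n%:R + p i) +
     (2 * pi * j%:Z%:~R * k%:R / n%:R + p j) by rewrite intrD; ring.
  have -> : 2 * pi * (i%:Z - j%:Z)%:~R * k%:R / n%:R + (p i - p j) =
     (2 * pi * i%:Z%:~R * k%:R / n%:R + p i) -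
     (2 * pi * j%:Z%:~R * k%:R / n%:R + p j) by rewrite intrB; ring.
  set a := 2 * pi * i%:Z%:~R * k%:R / n%:R + p i.
  set b := 2 * pi * j%:Z%:~R * k%:R / n%:R + p j.
  by rewrite (cosB a b) (cosD a b); field.
have iln := ltn_ord i; have jln := ltn_ord j.
have dvd_small (s : nat) : (s < n.*2)%N -> (n %| s)%N -> s = 0%N \/ s = n.
  by move=> sn /dvdnP[[|[|q]] sE]; [left | right | exfalso]; nia.
rewrite {}sumE; have [<-|ij] := eqVneq i j.
  rewrite !subrr dvdz0 cos0 -expr2 /c /p /cycle_amp /cycle_phase.
  have -> : (n %| i%:Z + i%:Z)%Z = (i == 0%N :> nat) || (i.*2 == n).
    rewrite -PoszD addnn dvdzE /=.
    apply/idP/idP => [/dvd_small|/orP[/eqP->|/eqP->]]; [|exact: dvdn0|exact: dvdnn].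
    by rewrite ltn_double => /(_ iln); lia.
  case: ifP => _; rewrite ?addr0 ?cos0 ?expr_div_n ?sqr_sqrtr ?ler0n ?divr_ge0 //.
  - by rewrite /= mulr1n expr1n; field.
  - by rewrite /= mulr1n; field.
have -> : (n %| i%:Z - j%:Z)%Z = false.
  apply/negP => /dvdzP[q qE]; move/eqP: ij; apply; apply: val_inj => /=.
  have [q0|[q1|q1]] : q = 0 \/ 1 <= q \/ q <= -1 by lia.
  - by rewrite q0 in qE; lia.
  - by nia.
  - by nia.
rewrite addr0 -PoszD dvdzE /=.
have {}ij : i != j :> nat by [].
case: ifP => [/dvd_small dvdij|]; last by rewrite mulr0.
have ijn : (i + j = n)%N by lia.
(* The remaining case: [i] and [j] index the two vectors of one eigenspace. *)
suff -> : cos (p i + p j) = 0 by rewrite !mulr0.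
wlog ltij : i j ij iln jln ijn {dvdij} / (i < j)%N.
  move=> H; case: (ltngtP i j) ij => // ltij _; first by apply: H; lia.
  by rewrite addrC; apply: H; lia.
have -> : p i = phi i - pi / 2.
  by rewrite /p /cycle_phase ifF ?ifT //; lia.
have -> : p j = - phi i.
  by rewrite /p /cycle_phase ifF ?ifF; [congr (- phi _)| |]; lia.
by rewrite addrAC subrr add0r cosN cos_pihalf.
Qed.

Lemma cycle_mx_family (R : realType) (phi : nat -> R) (n : nat) :
  cycle_family (cycle_mx phi n).
Proof.
split.
- apply/matrixP => i j; rewrite [RHS]mxE -(cycle_mx_dot phi) mxE.
  by apply: eq_bigr => k _; rewrite mxE.
- by move=> k j j0; rewrite mxE /= j0 eqxx.
- exists phi, 1%g, (fun=> false) => i i0; rewrite perm1; split=> // k.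
  by rewrite mxE /= eqn0Ngt i0 expr0 [RHS]mul1r.
Qed.

(** * The group generated by the sampling angle and a quarter turn *)

(** Half the spacing of the group generated by [2 * pi / n] and [pi / 2]. *)
Definition opt_phase (R : realType) (n : nat) : R := pi / (lcmn 4 n)%:R.

Lemma lcm4_mod0 n : (n = 0 %[mod 4])%N -> lcmn 4 n = n.
Proof. by move=> n4; apply/lcmn_idPr; rewrite /dvdn n4. Qed.

Lemma lcm4_mod2 n : (n = 2 %[mod 4])%N -> lcmn 4 n = (2 * n)%N.
Proof.
move=> n4; have -> : n = (2 * n./2)%N by lia.
have /eqP cop2 : coprime 2 n./2 by rewrite coprime2n; lia.
have := muln_lcm_gcd 2 n./2; rewrite cop2 muln1 -(muln_lcmr 2%N 2%N) => ->.
by [].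
Qed.

Lemma coprime4_odd n : odd n -> coprime 4 n.
Proof. by move=> nodd; apply: (@coprimeXl 2 2 n); rewrite coprime2n. Qed.

Lemma lcm4_odd n : odd n -> lcmn 4 n = (4 * n)%N.
Proof.
move=> nodd; have /eqP cop4 := coprime4_odd nodd.
by have := muln_lcm_gcd 4 n; rewrite cop4 muln1.
Qed.

(** [u] and [e] count the steps of length [2 * pi / lcm(4, n)] in a quarter turn
and in the sampling angle [2 * pi / n].  They are coprime, as [4] and [n] have
been divided by their greatest common divisor. *)
Lemma lcm4_factor n : (0 < n)%N -> exists e u : nat,
  [/\ lcmn 4 n = (4 * u)%N, lcmn 4 n = (e * n)%N, coprime e u,
      odd u = ~~ (8 %| n)%N & (e %| 4)%N].
Proof.
move=> n0; have [n4|[n4|nodd]] : (n = 0 %[mod 4] \/ n = 2 %[mod 4] \/ odd n)%N.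
- by lia.
- by exists 1%N, (n %/ 4)%N; rewrite lcm4_mod0 // coprime1n; split => //; lia.
- by exists 2%N, n./2; rewrite lcm4_mod2 // coprime2n; split => //; lia.
- exists 4%N, n; rewrite lcm4_odd // coprime4_odd //.
  by split => //; lia.
Qed.

(** * The optimal coherence *)

(** It suffices to bound the squares of the entries, since
[2 * `|x * y| <= x ^+ 2 + y ^+ 2]. *)
Lemma coherence_le (R : realType) (n : nat) (Q : 'M[R]_n) (b : R) : 0 <= b ->
  (forall k j : 'I_n, (0 < j)%N -> n%:R * Q k j ^+ 2 <= b) ->
  coherence Q <= b.
Proof.
move=> b0 le_b; apply: bigmax_le => // j j0.
apply: bigmax_le => // k _; apply: bigmax_le => // l _.
have := le_b k j j0; have := le_b l j j0.
have nR : 0 <= n%:R :> R by rewrite ler0n.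
rewrite normrM -![Q _ j ^+ 2]real_normK ?num_real //.
move: `|Q k j| `|Q l j| => x y; have := mulr_ge0 nR (sqr_ge0 (x - y)); nra.
Qed.

Lemma le_coherence (R : realType) (n : nat) (Q : 'M[R]_n) (k j : 'I_n) :
  (0 < j)%N -> n%:R * Q k j ^+ 2 <= coherence Q.
Proof.
move=> j0; apply: le_trans (le_bigmax_cond _ _ j0).
apply: le_trans (le_bigmax _ _ k); apply: le_trans (le_bigmax _ _ k).
by rewrite -expr2 ger0_norm ?sqr_ge0.
Qed.

Lemma lcm4_ge4 n : (0 < n)%N -> (4 <= lcmn 4 n)%N.
Proof. by move=> n0; rewrite dvdn_leq ?dvdn_lcml // lcmn_gt0. Qed.

Lemma opt_phase_bounds (R : realType) n : (0 < n)%N ->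
  0 < opt_phase R n <= pi / 4.
Proof.
move=> n0; have L4 := lcm4_ge4 n0.
have LR : 0 < (lcmn 4 n)%:R :> R by rewrite ltr0n; lia.
rewrite /opt_phase divr_gt0 ?pi_gt0 //= ler_pM2l ?pi_gt0 //.
by rewrite lef_pV2 ?posrE // ler_nat.
Qed.

Lemma opt_phase_cos_bounds (R : realType) n : (0 < n)%N ->
  1 <= 2 * cos (opt_phase R n) ^+ 2 < 2.
Proof.
move=> /(opt_phase_bounds R)/andP[g0 g4]; have pi0 := pi_gt0 R.
set g := opt_phase R n in g0 g4 *.
have c2 := cos_mulr2n g.
have : 0 <= cos (g *+ 2) by apply: cos_ge0_pihalf; rewrite -mulr_natr; lra.
have : cos g < cos 0 by rewrite ltr_cos // in_itv /=; lra.
have : 0 <= cos g by apply: cos_ge0_pihalf; lra.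
rewrite c2 cos0 -mulr_natr => cg0 cg1 cg2; apply/andP; split; nra.
Qed.

(** Measured in units of [opt_phase R n], the angle [theta] is odd and [pi / 2] is
even, so that [theta] and [theta + pi / 2] both fall under
[sqr_cos_le_odd]. *)
Lemma opt_phase_angle (R : realType) (n j k : nat) :
  (0 < n)%N ->
  let theta := 2 * pi * j%:R * k%:R / n%:R + opt_phase R n in
  cos theta ^+ 2 <= cos (opt_phase R n) ^+ 2 /\
  sin theta ^+ 2 <= cos (opt_phase R n) ^+ 2.
Proof.
move=> n0; have [e [u [Lu Le _ _ _]]] := lcm4_factor n0.
have u0 : (0 < u)%N by have := lcm4_ge4 n0; lia.
have e0 : (0 < e)%N by have := lcm4_ge4 n0; rewrite Le; case: (e).
have nR : n%:R != 0 :> R by rewrite pnatr_eq0 -lt0n.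
have eR : e%:R != 0 :> R by rewrite pnatr_eq0 -lt0n.
have uR : u%:R != 0 :> R by rewrite pnatr_eq0 -lt0n.
have gE : opt_phase R n = pi / (2 * (2 * u)%N%:R).
  by rewrite /opt_phase Lu !natrM; field.
have uE : u%:R = e%:R * n%:R / 4 :> R.
  by rewrite -natrM -Le Lu natrM; field.
have uP : (0 < 2 * u)%N by lia.
move=> theta.
have thetaE : theta = (2 * (e * j * k)).+1%:R * (pi / (2 * (2 * u)%N%:R)).
  by rewrite /theta gE -natr1 !natrM uE; field; rewrite nR eR.
have sinE : theta + pi / 2 =
    ((2 * (e * j * k)).+1 + 2 * u)%N%:R * (pi / (2 * (2 * u)%N%:R)).
  rewrite [in RHS]natrD [RHS]mulrDl -thetaE; congr (_ + _).
  by rewrite !natrM; field.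
split; first by rewrite thetaE gE; apply: sqr_cos_le_odd => //; lia.
rewrite -[sin _ ^+ 2]sqrrN -cosDpihalf sinE gE.
by apply: sqr_cos_le_odd => //; lia.
Qed.

Lemma coherence_cycle_mx_le (R : realType) n : (0 < n)%N ->
  coherence (cycle_mx (fun=> opt_phase R n) n) <=
  2 * cos (opt_phase R n) ^+ 2.
Proof.
move=> n0; have /andP[c1 _] := opt_phase_cos_bounds R n0.
have nR : n%:R != 0 :> R by rewrite pnatr_eq0 -lt0n.
have scale (x : R) : n%:R * (Num.sqrt (2 / n%:R) * x) ^+ 2 = 2 * x ^+ 2.
  by rewrite exprMn sqr_sqrtr ?divr_ge0 ?ler0n //; field.
apply: coherence_le => [|k j j0]; first by rewrite mulr_ge0 ?sqr_ge0.
rewrite mxE eqn0Ngt j0 /cycle_col.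
case: ifP => _; [|case: ifP => _].
- rewrite scale ler_pM2l //.
  by case: (opt_phase_angle R j k n0).
- rewrite expr_div_n sqrr_sign sqr_sqrtr ?ler0n // mulrC divfK //.
- rewrite scale ler_pM2l //.
  by case: (opt_phase_angle R (n - j) k n0).
Qed.

(** The grid point found by [sqr_cos_grid] need not be a sampled angle, but it is
one up to a multiple of [pi / 2]: a sampling step is [e] grid steps, a quarter
turn is [u] grid steps, and [e] is invertible modulo [u].  The quarter turns
account for the disjunction. *)
Lemma le_cycle_sincos (R : realType) (n : nat) (x : R) : (0 < n)%N ->
  exists k : 'I_n,
    cos (opt_phase R n) ^+ 2 <= cos (2 * pi * k%:R / n%:R + x) ^+ 2 \/
    cos (opt_phase R n) ^+ 2 <= sin (2 * pi * k%:R / n%:R + x) ^+ 2.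
Proof.
move=> n0; have [e [u [Lu Le eu _ _]]] := lcm4_factor n0.
have u0 : (0 < u)%N by have := lcm4_ge4 n0; lia.
have e0 : (0 < e)%N by have := lcm4_ge4 n0; rewrite Le; case: (e).
have nR : n%:R != 0 :> R by rewrite pnatr_eq0 -lt0n.
have eR : e%:R != 0 :> R by rewrite pnatr_eq0 -lt0n.
have uR : u%:R != 0 :> R by rewrite pnatr_eq0 -lt0n.
have gE : opt_phase R n = pi / (2 * (2 * u)%N%:R).
  by rewrite /opt_phase Lu !natrM; field.
have uE : u%:R = e%:R * n%:R / 4 :> R.
  by rewrite -natrM -Le Lu natrM; field.
have [|r] := @sqr_cos_grid R (2 * u) x; first by lia.
rewrite -gE => ler.
(* A solution of [e * k0 = r] modulo [u], obtained as a multiple of [e]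
   congruent to [r]; it is then reduced modulo [n], which is harmless because
   [e * n = 4 * u]. *)
have /dvdnP[k0 ck] : (e %| chinese e u 0 r)%N.
  by rewrite /dvdn chinese_modl // mod0n.
have kr : (e * (k0 %% n) = r %[mod u])%N.
  rewrite -(chinese_modr eu 0 r) ck [in RHS](divn_eq k0 n).
  have -> : ((k0 %/ n * n + k0 %% n) * e = k0 %/ n * 4 * u + e * (k0 %% n))%N.
    by rewrite mulnDl -mulnA [(n * e)%N]mulnC -Le Lu; lia.
  by rewrite modnMDl.
exists (Ordinal (ltn_pmod k0 n0)) => /=.
move: (k0 %% n)%N kr => k kr.
pose z : int := (e * k %/ u)%N%:Z - (r %/ u)%N%:Z.
have shift : 2 * pi * k%:R / n%:R + x =
             x + r%:R * (pi / (2 * u)%N%:R) + z%:~R * (pi / 2).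
  have ekE : e%:R * k%:R = r%:R + z%:~R * u%:R :> R.
    rewrite -natrM (divn_eq (e * k) u) {1}(divn_eq r u) kr /z intrB -!pmulrn.
    by rewrite !natrD !natrM; ring.
  have -> : k%:R = (r%:R + z%:~R * u%:R) / e%:R :> R by rewrite -ekE; field.
  by rewrite natrM uE; field; rewrite nR eR.
by rewrite shift; case: (sqr_cosDzpihalf (x + r%:R * (pi / (2 * u)%N%:R)) z) => ->;
  [left | right].
Qed.

(** The sine and the cosine column of frequency 1, of indices [1] and [n.-1] in the
reference order, already force the bound. *)
Lemma le_coherence_cycle (R : realType) (n : nat) (Q : 'M[R]_n) :
  (2 <= n)%N -> cycle_family Q -> 2 * cos (opt_phase R n) ^+ 2 <= coherence Q.
Proof.
move=> n2 [_ _ [phi [s [e famQ]]]].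
have n0 : (0 < n)%N by lia.
have nR : n%:R != 0 :> R by rewrite pnatr_eq0 -lt0n.
have ge_col (i k : 'I_n) : (0 < i)%N ->
    n%:R * cycle_col n phi i k ^+ 2 <= coherence Q.
  move=> i0; have [si0 /(_ k) QE] := famQ i i0.
  by apply: le_trans (le_coherence Q k si0); rewrite QE exprMn sqrr_sign mul1r.
have [n2E|n3] : n = 2%N \/ (2 < n)%N by lia.
  have -> : 2 * cos (opt_phase R n) ^+ 2 = 1.
    have := cos_mulr2n (opt_phase R n).
    have -> : opt_phase R n *+ 2 = pi / 2.
      by rewrite /opt_phase n2E lcm4_mod2 // natrM -mulr_natr; field.
    by rewrite cos_pihalf -mulr_natr; lra.
  apply: le_trans (ge_col (Ordinal n2) (Ordinal n0) isT).
  have -> : cycle_col n phi (Ordinal n2) (Ordinal n0) = cycle_alt R n 0.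
    by rewrite /cycle_col /= ifF ?ifT //; lia.
  by rewrite /cycle_alt expr_div_n expr1n sqr_sqrtr ?ler0n // mulrC divfK.
have scale (x : R) : n%:R * (Num.sqrt (2 / n%:R) * x) ^+ 2 = 2 * x ^+ 2.
  by rewrite exprMn sqr_sqrtr ?divr_ge0 ?ler0n //; field.
have nn : (n.-1 < n)%N by lia.
have [k [lek|lek]] := le_cycle_sincos (phi 1%N) n0.
- apply: le_trans (ge_col (Ordinal nn) k _); last by rewrite /=; lia.
  rewrite /cycle_col /= ifF ?ifF; [|lia|lia].
  have -> : (n - n.-1 = 1)%N by lia.
  by rewrite /cycle_cos scale mulr1 ler_pM2l.
- apply: le_trans (ge_col (Ordinal n2) k isT).
  by rewrite /cycle_col /= ifT // /cycle_sin scale mulr1 ler_pM2l.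
Qed.

Lemma coherence_cycle_mx (R : realType) n : (2 <= n)%N ->
  coherence (cycle_mx (fun=> opt_phase R n) n) = 2 * cos (opt_phase R n) ^+ 2.
Proof.
move=> n2; apply/eqP; rewrite eq_le coherence_cycle_mx_le ?(ltnW n2) //=.
exact: le_coherence_cycle (cycle_mx_family _ _).
Qed.

(** * The threshold of the canonical basis *)

Lemma Delta_opt_phase (R : realType) (n : nat) : (0 < n)%N ->
  ~~ (8 %| n)%N -> Delta R n = opt_phase R n.
Proof.
move=> n0; have [e [u [Lu Le _ <- e4]]] := lcm4_factor n0 => uodd.
have /andP[g0 _] := opt_phase_bounds R n0.
have nR : n%:R != 0 :> R by rewrite pnatr_eq0 -lt0n.
have LR : (lcmn 4 n)%:R != 0 :> R by rewrite pnatr_eq0 -lt0n; have := lcm4_ge4 n0; lia.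
have distE (m t : int) :
    `|2 * pi * m%:~R / n%:R - (2 * t + 1)%:~R * pi / 4| =
    `|2 * e%:Z * m - (2 * t + 1) * u%:Z|%:~R * opt_phase R n :> R.
  rewrite -[opt_phase R n](gtr0_norm g0) intr_norm -normrM; congr `|_|.
  have eE : e%:R = (lcmn 4 n)%:R / n%:R :> R by rewrite Le natrM mulfK.
  have uE : u%:R = (lcmn 4 n)%:R / 4 :> R by rewrite Lu natrM; field.
  rewrite /opt_phase intrB !intrM -!pmulrn eE uE; field.
  by rewrite nR LR.
rewrite /Delta; set A := (X in inf X).
have lbA : lbound A (opt_phase R n).
  move=> _ [m [t ->]]; rewrite distE ler_peMl ?(ltW g0) // ler1z.
  by lia.
have Ag : A (opt_phase R n).
  (* The minimal distance is attained at [2 * t + 1 = u], because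
     [u ^ 2 = 1] modulo 8 and [2 * e] divides 8. *)
  have /dvdnP[c uu] : (e.*2 %| u ^ 2 - 1)%N.
    apply: (@dvdn_trans (4 * 2)); first by rewrite -muln2 dvdn_pmul2r.
    have -> : (u ^ 2 - 1 = 4 * (u./2 * (u./2).+1))%N.
      by rewrite -[in LHS](odd_double_half u) uodd -mul2n; lia.
    by rewrite dvdn_pmul2l // dvdn2 oddM /= andbN.
  exists c%:Z, (u./2)%:Z; rewrite distE.
  have -> : 2 * e%:Z * c%:Z - (2 * (u./2)%:Z + 1) * u%:Z = - 1 by nia.
  by rewrite normrN1 mul1r.
apply/eqP; rewrite eq_le ge_inf //=; last by exists (opt_phase R n).
by apply: lb_le_inf => //; exists (opt_phase R n).
Qed.

Lemma Delta_eq0 (R : realType) (n : nat) : (0 < n)%N -> (8 %| n)%N ->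
  Delta R n = 0.
Proof.
move=> n0 /dvdnP[q nE].
rewrite /Delta; set A := (X in inf X).
have lbA : lbound A 0 by move=> _ [m [t ->]].
have A0 : A 0.
  exists q%:Z, 0; rewrite mulr0 add0r -pmulrn nE natrM.
  have q0 : q%:R != 0 :> R by rewrite pnatr_eq0; lia.
  rewrite [X in `|X|](_ : _ = 0) ?normr0 //; field; exact: q0.
apply/eqP; rewrite eq_le ge_inf //=; last by exists 0.
by apply: lb_le_inf => //; exists 0.
Qed.

(** * Bounds, comparison and monotone convergence of the optimal threshold *)

Definition opt_threshold (R : realType) (n : nat) : R :=
  1 - 1 / (2 * cos (opt_phase R n) ^+ 2).

Lemma opt_threshold_bounds (R : realType) n : (0 < n)%N ->
  0 <= opt_threshold R n < 1 / 2.
Proof.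
move=> /(opt_phase_cos_bounds R)/andP[]; rewrite /opt_threshold.
move: (2 * _) => c c1 c2; have c0 : 0 < c by lra.
have vc : c * c^-1 = 1 by rewrite mulfV ?gt_eqF.
have v0 : 0 < c^-1 by rewrite invr_gt0.
rewrite div1r; apply/andP; split; nra.
Qed.

Lemma opt_threshold_eq_delta (R : realType) n : (0 < n)%N ->
  opt_threshold R n = delta R n <-> ~~ (8 %| n)%N.
Proof.
move=> n0; split=> [|n8]; last by rewrite /delta Delta_opt_phase.
apply: contra_eqN => n8; rewrite /delta Delta_eq0 // cos0 expr1n mulr1.
have /andP[_] := opt_threshold_bounds R n0; lra.
Qed.

(** Along a class where [lcm(4, n)] is [c * n], the phase is [pi / (c * n)]; it stays
in [`]0, pi / 4]], where the cosine is positive and strictly decreasing. *)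
Lemma opt_threshold_increases (R : realType) (C : set nat) (c : nat)
    (u : nat -> R) : (0 < c)%N ->
  (forall n, C n -> (0 < n)%N) ->
  (forall n, C n -> lcmn 4 n = (c * n)%N) ->
  (forall n, C n -> u n = opt_threshold R n) ->
  increases_to C u (1 / 2).
Proof.
move=> c0 C0 CL Cu; have pi0 := pi_gt0 R; split=> [m n Cm Cn mn|].
  rewrite !Cu //.
  have /andP[gm0 gm4] := opt_phase_bounds R (C0 _ Cm).
  have /andP[gn0 gn4] := opt_phase_bounds R (C0 _ Cn).
  have glt : opt_phase R n < opt_phase R m.
    rewrite /opt_phase !CL // ltr_pM2l // ltf_pV2 ?posrE ?ltr0n ?muln_gt0 ?c0 ?C0 //.
    by rewrite ltr_nat ltn_pmul2l.
  have /andP[cm1 _] := opt_phase_cos_bounds R (C0 _ Cm).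
  have cmn : cos (opt_phase R m) < cos (opt_phase R n).
    by rewrite ltr_cos // in_itv /=; lra.
  have cm0 : 0 <= cos (opt_phase R m) by apply: cos_ge0_pihalf; lra.
  rewrite /opt_threshold ltrD2l ltrN2 !div1r.
  have lt2 : 2 * cos (opt_phase R m) ^+ 2 < 2 * cos (opt_phase R n) ^+ 2.
    by rewrite ltr_pM2l // ltr_pXn2r // ?nnegrE //; lra.
  by rewrite ltf_pV2 ?posrE //; lra.
(* [v] extends the threshold from [C] to all of [nat] by its formula, so that
   an ordinary limit can be taken before restricting to [C]. *)
pose v (n : nat) : R := 1 - (2 * cos (pi / c%:R * n%:R^-1) ^+ 2)^-1.
have v_lim : v n @[n --> \oo] --> (1 / 2 : R).
  have inv0 : (n%:R : R)^-1 @[n --> \oo] --> (0 : R).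
    apply/gtr0_cvgV0; last exact: cvgr_idn.
    by near=> n; rewrite ltr0n; near: n; exact: nbhs_infty_gt.
  have arg0 : pi / c%:R * (n%:R : R)^-1 @[n --> \oo] --> (0 : R).
    by rewrite -[X in _ --> X](mulr0 (pi / c%:R)); exact: cvgMr inv0.
  have := cvg_comp _ _ arg0 (@continuous_cos R 0); rewrite cos0 => cos1.
  have -> : 1 / 2 = 1 - (2 * 1 ^+ 2)^-1 :> R by rewrite expr1n; field.
  apply: cvgB; first exact: cvg_cst.
  apply: cvgV; first by rewrite expr1n mulr1.
  apply: cvgMr; rewrite expr2.
  have -> : (fun n : nat => cos (pi / c%:R * (n%:R : R)^-1) ^+ 2) =
    (fun n : nat => cos (pi / c%:R * (n%:R : R)^-1) * cos (pi / c%:R * (n%:R : R)^-1)).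
    by apply/funext => n; rewrite expr2.
  exact: cvgM.
apply: cvg_trans (cvg_within_filter C v_lim).
apply: near_eq_cvg; rewrite near_withinE; apply: nearW => n Cn.
rewrite Cu // /opt_threshold /opt_phase CL // /v natrM.
by rewrite (invfM c%:R) (mulrA pi) div1r.
Unshelve. all: by end_near.
Qed.

(** * The theorem *)

Theorem theorem7 (R : realType) :
  exists Qph : forall n : nat, 'M[R]_n,
    (forall n : nat, (2 <= n)%N ->
      cycle_family (Qph n) /\
      ((n = 0 %[mod 4])%N ->
        coherence (Qph n) = 2 * cos (pi / n%:R) ^+ 2) /\
      ((n = 2 %[mod 4])%N ->
        coherence (Qph n) = 2 * cos (pi / (2 * n%:R)) ^+ 2) /\
      (odd n ->
        coherence (Qph n) = 2 * cos (pi / (4 * n%:R)) ^+ 2) /\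
      (forall Q : 'M[R]_n, cycle_family Q ->
        coherence (Qph n) <= coherence Q) /\
      ((n = 0 %[mod 4])%N ->
        threshold (Qph n) = 1 - 1 / (2 * cos (pi / n%:R) ^+ 2)) /\
      ((n = 2 %[mod 4])%N ->
        threshold (Qph n) = 1 - 1 / (2 * cos (pi / (2 * n%:R)) ^+ 2)) /\
      (odd n ->
        threshold (Qph n) = 1 - 1 / (2 * cos (pi / (4 * n%:R)) ^+ 2)) /\
      ((3 <= n)%N -> 0 <= threshold (Qph n) < 1 / 2) /\
      (threshold (Qph n) = delta R n <-> ~~ (8 %| n)%N)) /\
    increases_to [set n | (2 <= n)%N /\ (n = 0 %[mod 4])%N]
      (fun n => threshold (Qph n)) (1 / 2) /\
    increases_to [set n | (2 <= n)%N /\ (n = 2 %[mod 4])%N]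
      (fun n => threshold (Qph n)) (1 / 2) /\
    increases_to [set n | (2 <= n)%N /\ odd n]
      (fun n => threshold (Qph n)) (1 / 2).

Proof.
pose Qph n : 'M[R]_n := cycle_mx (fun=> opt_phase R n) n.
have cohE n : (2 <= n)%N -> coherence (Qph n) = 2 * cos (opt_phase R n) ^+ 2.
  exact: coherence_cycle_mx.
have thrE n : (2 <= n)%N -> threshold (Qph n) = opt_threshold R n.
  by move=> n2; rewrite /threshold cohE.
have mod0 n : (n = 0 %[mod 4])%N -> opt_phase R n = pi / n%:R.
  by move=> n4; rewrite /opt_phase lcm4_mod0.
have mod2 n : (n = 2 %[mod 4])%N -> opt_phase R n = pi / (2 * n%:R).
  by move=> n4; rewrite /opt_phase lcm4_mod2 // natrM.
have modd n : odd n -> opt_phase R n = pi / (4 * n%:R).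
  by move=> nodd; rewrite /opt_phase lcm4_odd // natrM.
exists Qph; split=> [n n2|].
  have n0 : (0 < n)%N by apply: ltnW.
  rewrite thrE // cohE //; split; first exact: cycle_mx_family.
  split; first by move=> /mod0->.
  split; first by move=> /mod2->.
  split; first by move=> /modd->.
  split; first by move=> Q; apply: le_coherence_cycle.
  split; first by move=> /mod0 <-.
  split; first by move=> /mod2 <-.
  split; first by move=> /modd <-.
  split; first by move=> _; apply: opt_threshold_bounds.
  exact: opt_threshold_eq_delta.
split; [|split].
- apply: (@opt_threshold_increases _ _ 1) => // n [n2 n4].
  + exact: ltnW.
  + by rewrite lcm4_mod0 // mul1n.
  + exact: thrE.
- apply: (@opt_threshold_increases _ _ 2) => // n [n2 n4].
  + exact: ltnW.
  + exact: lcm4_mod2.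
  + exact: thrE.
- apply: (@opt_threshold_increases _ _ 4) => // n [n2 nodd].
  + exact: ltnW.
  + exact: lcm4_odd.
  + exact: thrE.
Qed.
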